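(* $\mathfrak{S}_1(\mathrm{A},\mathrm{D}_3)=\mathfrak{S}_1=\{1\}$, and for $n\ge 2$, $|\mathfrak{S}_n(\mathrm{A},\mathrm{D}_3)|=n-1$. More precisely, for $n\ge2$, $$\mathfrak{S}_n(\mathrm{A},\mathrm{D}_3)=\{a(a+1)\cdots(n-1)n\,12\cdots(a-1): 2\le a\le n\},$$ where permutations are written in one-line notation.
   Context: $\mathfrak{S}_n$ is the set of permutations $\sigma=\sigma_1\sigma_2\cdots\sigma_n$ of $[n]=\{1,\dots,n\}$ in one-line notation. A mesh pattern is a pair $p=(\pi,R)$ with $\pi\in\mathfrak{S}_m$ and $R\subseteq\{0,\dots,m\}\times\{0,\dots,m\}$ (the set of shaded unit cells, each given by its bottom-left corner, in the grid with dots at $(i,\pi_i)$). An occurrence of $p$ in $\sigma\in\mathfrak{S}_n$ is a choice of indices $i_1<\cdots<i_m$ such that $\sigma_{i_1}\cdots\sigma_{i_m}$ is order-isomorphic to $\pi$ and, for every $(a,b)\in R$, there is no index $r$ with $i_a<r<i_{a+1}$ and $v_b<\sigma_r<v_{b+1}$; here $v_1<\cdots<v_m$ is the increasing rearrangement of $\sigma_{i_1},\dots,\sigma_{i_m}$, $i_0=v_0=0$ and $i_{m+1}=v_{m+1}=n+1$. $\mathfrak{S}_n(p,q)$ is the set of permutations in $\mathfrak{S}_n$ with no occurrence of $p$ and no occurrence of $q$. The mesh patterns: $\mathrm{A}=(12,\{(0,2),(2,0)\})$ and $\mathrm{D}_3=(321,\{(0,0),(3,3)\})$. *)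

(* Defs.v *)
From mathcomp Require Import all_boot all_fingroup.

Set Implicit Arguments.
Unset Strict Implicit.
Unset Printing Implicit Defensive.

(* The elements of 'S_n permute {0, ..., n-1}; positions and values are shifted
   by one so that words, indices and letters range over {1, ..., n}. *)
Definition one_line n (s : 'S_n) : seq nat := [seq (s i).+1 | i <- enum 'I_n].

Record mesh_pattern := MeshPattern {
  mesh_size : nat;
  mesh_perm : 'S_mesh_size;
  mesh_shading : {set 'I_mesh_size.+1 * 'I_mesh_size.+1}
}.

(* With c_1, ..., c_m the entries of c, [grid_line n c k] is c_k, where
   c_0 = 0 and c_(m+1) = n + 1. *)
Definition grid_line (n : nat) (c : seq nat) (k : nat) : nat :=
  nth 0 (0 :: rcons c n.+1) k.

Section Occurrence.

Variables (p : mesh_pattern) (n : nat) (s : 'S_n).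
Variable f : {ffun 'I_(mesh_size p) -> 'I_n}.

Definition occ_indices : seq nat :=
  [seq (f j).+1 | j <- enum 'I_(mesh_size p)].

Definition occ_values : seq nat :=
  sort leq [seq (s (f j)).+1 | j <- enum 'I_(mesh_size p)].

Definition in_cell (a b : nat) (r : 'I_n) : bool :=
  (grid_line n occ_indices a < r.+1 < grid_line n occ_indices a.+1) &&
  (grid_line n occ_values b < (s r).+1 < grid_line n occ_values b.+1).

Definition is_occurrence : bool :=
  [&& [forall j : 'I_(mesh_size p), forall k : 'I_(mesh_size p),
         (j < k) ==> (f j < f k)],
      [forall j : 'I_(mesh_size p), forall k : 'I_(mesh_size p),
         (s (f j) < s (f k)) == (mesh_perm p j < mesh_perm p k)]
    & [forall ab in mesh_shading p, forall r, ~~ in_cell ab.1 ab.2 r]].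

End Occurrence.

Definition contains (p : mesh_pattern) n (s : 'S_n) : bool :=
  [exists f, is_occurrence (p := p) s f].

Definition avoiders n (p q : mesh_pattern) : {set 'S_n} :=
  [set s | ~~ contains p s & ~~ contains q s].

Definition meshA : mesh_pattern :=
  @MeshPattern 2 1%g [set (ord0, ord_max); (ord_max, ord0)].

Definition meshD3 : mesh_pattern :=
  @MeshPattern 3 (perm (@rev_ord_inj 3)) [set (ord0, ord0); (ord_max, ord_max)].

Lemma one_line_meshA : one_line (mesh_perm meshA) = [:: 1; 2].
Proof. by rewrite /one_line /= !enum_ordSl enum_ord0 /= !perm1. Qed.

Lemma one_line_meshD3 : one_line (mesh_perm meshD3) = [:: 3; 2; 1].
Proof. by rewrite /one_line /= !enum_ordSl enum_ord0 /= !permE. Qed.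

(* a (a+1) ... n 1 2 ... (a-1); [index_iota u v] excludes v. *)
Definition rotated_word (n a : nat) : seq nat :=
  index_iota a n.+1 ++ index_iota 1 a.

(* Main.v *)
Require Import Defs.
From mathcomp Require Import all_boot all_fingroup.
From mathcomp Require Import zify.

Set Implicit Arguments.
Unset Strict Implicit.
Unset Printing Implicit Defensive.

(** Write 1 and n for the smallest and the largest letter of a word of length
    n >= 2 that avoids both patterns.

    Nothing exceeds n and nothing is below 1, so if 1 came before n, this pair
    would be an occurrence of A; hence n comes first. For the same reason the
    shaded cells of D3 are empty for any triple n y 1, so no letter y lies
    between them and the word reads u n 1 v (avoider_peak_bottom).

    All letters of u n exceed all letters of 1 v. Otherwise take x least in u n
    and y greatest in 1 v, so that x < y. As x y is not an occurrence of A,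
    either some z > y precedes x, and then z x 1 is an occurrence of D3 by
    maximality of y, or some z < x follows y, and then n y z is an occurrence of
    D3 by minimality of x. Finally a descent z x inside u n would give the
    occurrence z x 1 of D3, and a descent y z inside 1 v the occurrence n y z,
    so both blocks increase (avoider_blocks). Exchanging the blocks sorts the
    word, which is therefore a rotation of 1 2 ... n (avoider_rotated).

    Conversely (avoiders_rotated), a rotation made of two nonempty blocks has no
    321 at all, and each ascent in it lies in one block: in the left block, the
    letter 1 sits in the shaded cell (2,0); in the right block, the letter n
    sits in the shaded cell (0,2). Distinct values of a give words with distinct
    first letters, whence the count. *)

(** * Occurrences of the two patterns *)

Lemma forall_in_set2 (T : finType) (x y : T) (P : pred T) :
  [forall z in [set x; y], P z] = P x && P y.
Proof.
apply/forall_inP/andP => [H|[Hx Hy] z].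
  by split; apply: H; rewrite !inE eqxx ?orbT.
by rewrite !inE => /orP[] /eqP->.
Qed.

Lemma enum_I2 : enum 'I_2 = [:: ord0; ord_max].
Proof. by apply: (inj_map val_inj); rewrite val_enum_ord. Qed.

Lemma enum_I3 : enum 'I_3 = [:: ord0; Ordinal (isT : 1 < 3); ord_max].
Proof. by apply: (inj_map val_inj); rewrite val_enum_ord. Qed.

(** Each shaded cell of A is a corner quadrant, since it touches two sides of
    the grid: emptiness involves only one position bound and one value bound.
    The bounds are weak because negating them yields the inhabitant of a
    shaded cell that avoidance provides. *)
Lemma contains_meshAP n (s : 'S_n) :
  reflect (exists i j : 'I_n,
             [/\ i < j, s i < s j, forall r : 'I_n, r < i -> s r <= s j
               & forall r : 'I_n, j < r -> s i <= s r])
          (contains meshA s).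
Proof.
have vals (f : {ffun 'I_2 -> 'I_n}) : s (f ord0) < s (f ord_max) ->
    occ_values (p := meshA) s f = [:: (s (f ord0)).+1; (s (f ord_max)).+1].
  move=> lt_s; rewrite /occ_values enum_I2 sorted_sort //=; first exact: leq_trans.
  by lia.
have idx (f : {ffun 'I_2 -> 'I_n}) :
    occ_indices (p := meshA) f = [:: (f ord0).+1; (f ord_max).+1].
  by rewrite /occ_indices enum_I2.
apply: (iffP existsP) => [[f]|[i [j [lt_ij lt_s left_of right_of]]]].
  case/and3P=> /forallP/(_ ord0)/forallP/(_ ord_max)/= lt_ij.
  move=> /forallP/(_ ord0)/forallP/(_ ord_max); rewrite /= !perm1 /= => /eqP lt_s.
  rewrite forall_in_set2 /in_cell vals // idx /grid_line /=.
  case/andP=> /forallP no02 /forallP no20.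
  exists (f ord0), (f ord_max); split=> // r lt_r.
    by rewrite leqNgt; apply: contra (no02 r) => lt_sr; rewrite !ltnS lt_r lt_sr /=.
  by rewrite leqNgt; apply: contra (no20 r) => lt_sr; rewrite !ltnS lt_r lt_sr /= andbT.
pose f : {ffun 'I_2 -> 'I_n} := [ffun k => tnth [tuple i; j] k].
have f0 : f ord0 = i by rewrite ffunE.
have f1 : f ord_max = j by rewrite ffunE.
have two (k : 'I_2) : k = ord0 \/ k = ord_max.
  by case: k => [[|[|//]] lt_k]; [left|right]; apply: val_inj.
exists f; apply/and3P; split.
- apply/forallP=> k; apply/forallP=> l.
  by case: (two k) => ->; case: (two l) => ->; rewrite ?f0 ?f1 //=; lia.
- apply/forallP=> k; apply/forallP=> l.
  by case: (two k) => ->; case: (two l) => ->; rewrite ?f0 ?f1 !perm1 //=; lia.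
rewrite forall_in_set2 /in_cell vals ?idx ?f0 ?f1 // /grid_line /=.
apply/andP; split; apply/forallP=> r.
  by have := left_of r; lia.
by have := right_of r; lia.
Qed.

(** As for A, the two shaded cells are corner quadrants, here below and to the
    left of the whole occurrence, and above and to the right of it. *)
Lemma contains_meshD3P n (s : 'S_n) :
  reflect (exists i j k : 'I_n,
             [/\ i < j < k, s k < s j < s i,
                 forall r : 'I_n, r < i -> s k <= s r
               & forall r : 'I_n, k < r -> s r <= s i])
          (contains meshD3 s).
Proof.
pose o1 := Ordinal (isT : 1 < 3).
have vals (f : {ffun 'I_3 -> 'I_n}) :
    s (f ord_max) < s (f o1) < s (f ord0) ->
    occ_values (p := meshD3) s f =
    [:: (s (f ord_max)).+1; (s (f o1)).+1; (s (f ord0)).+1].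
  move=> lt_s; rewrite /occ_values enum_I3 /=.
  apply: (sorted_eq leq_trans anti_leq); first exact: sort_sorted leq_total _.
    by rewrite /=; lia.
  by rewrite perm_sort -(perm_rev [:: _; _; _]).
have idx (f : {ffun 'I_3 -> 'I_n}) :
    occ_indices (p := meshD3) f = [:: (f ord0).+1; (f o1).+1; (f ord_max).+1].
  by rewrite /occ_indices enum_I3.
apply: (iffP existsP) => [[f]|[i [j [k [lt_ijk lt_s left_of right_of]]]]].
  case/and3P=> /forallP inc /forallP ord_iso.
  have lt_01 := implyP (forallP (inc ord0) o1) isT.
  have lt_12 := implyP (forallP (inc o1) ord_max) isT.
  have /eqP := forallP (ord_iso o1) ord0; rewrite !permE /= => lt_s10.
  have /eqP := forallP (ord_iso ord_max) o1; rewrite !permE /= => lt_s21.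
  rewrite forall_in_set2 /in_cell vals ?lt_s10 ?lt_s21 // idx /grid_line /=.
  case/andP=> /forallP no00 /forallP no33.
  exists (f ord0), (f o1), (f ord_max); split=> [|| r lt_r | r lt_r].
  - by rewrite lt_01 lt_12.
  - by rewrite lt_s10 lt_s21.
  - by rewrite leqNgt; apply: contra (no00 r) => lt_sr; rewrite !ltnS lt_r lt_sr.
  rewrite leqNgt; apply: contra (no33 r) => lt_sr.
  by rewrite !ltnS lt_r lt_sr !ltn_ord.
pose f : {ffun 'I_3 -> 'I_n} := [ffun l => tnth [tuple i; j; k] l].
have f0 : f ord0 = i by rewrite ffunE.
have f1 : f o1 = j by rewrite ffunE.
have f2 : f ord_max = k by rewrite ffunE.
have three (l : 'I_3) : [\/ l = ord0, l = o1 | l = ord_max].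
  case: l => [[|[|[|//]]] lt_l];
    [apply: Or31|apply: Or32|apply: Or33]; exact: val_inj.
exists f; apply/and3P; split.
- apply/forallP=> l; apply/forallP=> m.
  by case: (three l) => ->; case: (three m) => ->;
    rewrite ?f0 ?f1 ?f2 //=; lia.
- apply/forallP=> l; apply/forallP=> m.
  by case: (three l) => ->; case: (three m) => ->;
    rewrite ?f0 ?f1 ?f2 !permE //=; lia.
rewrite forall_in_set2 /in_cell vals ?idx ?f0 ?f1 ?f2 // /grid_line /=.
apply/andP; split; apply/forallP=> r.
  by have := left_of r; lia.
by have := right_of r; lia.
Qed.

(** * Words of permutations and rotations *)

(** This is what produces a permutation from a rotated word. *)
Lemma one_line_perm_eq n (w : seq nat) :
  reflect (exists s : 'S_n, w = one_line s) (perm_eq w (iota 1 n)).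
Proof.
have sz : size (iota 1 n) == n by rewrite size_iota.
have oneE (s : 'S_n) :
    one_line s = [tuple tnth (Tuple sz) (s i) | i < n] :> seq nat.
  rewrite /one_line /=; apply: eq_map => i.
  by rewrite (tnth_nth 0) /= nth_iota.
apply: (iffP idP) => [/(@tuple_permP _ n w (Tuple sz))[s ->] | [s ->]].
  by exists s; rewrite oneE.
by apply/(@tuple_permP _ n _ (Tuple sz)); exists s; rewrite oneE.
Qed.

Lemma nth_one_line n (s : 'S_n) (i : 'I_n) : nth 0 (one_line s) i = (s i).+1.
Proof. by rewrite (nth_map i) ?size_enum_ord // nth_ord_enum. Qed.

Lemma size_one_line n (s : 'S_n) : size (one_line s) = n.
Proof. by rewrite size_map size_enum_ord. Qed.

Lemma one_line_inj n : injective (@one_line n).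
Proof.
move=> s t eq_st; apply/permP=> i; apply/val_inj/succn_inj.
by rewrite -!nth_one_line eq_st.
Qed.

Lemma rotated_wordE n a : 0 < a <= n ->
  rotated_word n a = rot a.-1 (iota 1 n).
Proof.
case: a => // a lt_an.
rewrite /rotated_word /rot /index_iota drop_iota take_iota /= subn1 /=.
by congr (iota _ _ ++ iota _ _); lia.
Qed.

Lemma nth_rotated_word n a i : a <= n -> i < n ->
  nth 0 (rotated_word n a) i =
  if i < n.+1 - a then a + i else (i - (n.+1 - a)).+1.
Proof.
move=> le_an lt_in; rewrite nth_cat size_iota.
by case: ifP => lt_i; rewrite nth_iota //; lia.
Qed.

Lemma rotated_word_inj n : {in [pred a | 0 < a <= n] &, injective (rotated_word n)}.
Proof.
move=> a b /andP[a_gt0 le_an] /andP[b_gt0 le_bn] /(congr1 (nth 0 ^~ 0)).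
by rewrite !nth_rotated_word //; try lia; do 2 case: ifP; lia.
Qed.

(** * Rotations avoid both patterns *)

Lemma avoiders_rotated n a (s : 'S_n) : 2 <= a <= n ->
  one_line s = rotated_word n a -> s \in avoiders n meshA meshD3.
Proof.
move=> a_bd s_rot.
have sE (i : 'I_n) : s i =
    (if i < n.+1 - a then a + i - 1 else i - (n.+1 - a)) :> nat.
  have := nth_one_line s i; rewrite s_rot nth_rotated_word //; last by lia.
  by case: ifP; lia.
rewrite inE; apply/andP; split.
  apply/contains_meshAP=> -[i [j [lt_ij lt_s left_of right_of]]].
  (* The letter 1 is at position n.+1 - a and the letter n just before it: they
     sit in the shaded cell of any ascent of the left, resp. right, block. *)
  have lt_1 : n.+1 - a < n by lia.
  have lt_n : n - a < n by lia.
  have := right_of (Ordinal lt_1); have := left_of (Ordinal lt_n).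
  have := ltn_ord j; move: lt_s; rewrite !sE /=.
  by do ! case: ifP; lia.
apply/contains_meshD3P=> -[i [j [k [lt_ijk lt_s _ _]]]].
by move: lt_s; rewrite !sE; do ! case: ifP; lia.
Qed.

(** * Avoiders are rotations *)

Section Avoider.

Variables (n : nat) (s : 'S_n).
Hypotheses (n_gt1 : 1 < n) (s_av : s \in avoiders n meshA meshD3).

Lemma avoids_meshA (i j : 'I_n) : i < j -> s i < s j ->
  (exists2 r : 'I_n, r < i & s j < s r) \/ (exists2 r : 'I_n, j < r & s r < s i).
Proof.
move=> lt_ij lt_s.
case: (boolP [exists r : 'I_n, (r < i) && (s j < s r)]) => [|no_l].
  by case/existsP=> r /andP[]; left; exists r.
case: (boolP [exists r : 'I_n, (j < r) && (s r < s i)]) => [|no_r].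
  by case/existsP=> r /andP[]; right; exists r.
move: s_av; rewrite inE => /andP[/contains_meshAP[]]; exists i, j; split=> // r lt_r.
  by move/existsPn/(_ r): no_l; rewrite lt_r -leqNgt.
by move/existsPn/(_ r): no_r; rewrite lt_r -leqNgt.
Qed.

Lemma avoids_meshD3 (i j k : 'I_n) : i < j < k -> s k < s j < s i ->
  (forall r : 'I_n, r < i -> s k <= s r) ->
  (forall r : 'I_n, k < r -> s r <= s i) -> False.
Proof.
move=> lt_ijk lt_s l r; move: s_av; rewrite inE => /andP[_ /contains_meshD3P].
by case; exists i, j, k.
Qed.

(** The extreme letters make every shaded cell next to them empty, so that
    1 before n would be an occurrence of A, and any letter between n and 1
    would complete them to an occurrence of D3. *)
Lemma avoider_peak_bottom :
  exists p q : 'I_n, [/\ s p = n.-1 :> nat, s q = 0 :> nat & q = p.+1 :> nat].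
Proof.
have lt_top : n.-1 < n by lia.
have lt_bot : 0 < n by lia.
pose p := s^-1%g (Ordinal lt_top); pose q := s^-1%g (Ordinal lt_bot).
have sp : s p = n.-1 :> nat by rewrite permKV.
have sq : s q = 0 :> nat by rewrite permKV.
exists p, q; split=> //.
have le_top (i : 'I_n) : s i <= s p by have := ltn_ord (s i); lia.
have neq_pq : p != q :> nat.
  by apply/eqP=> /val_inj eq_pq; move: sp; rewrite eq_pq; lia.
case: (ltngtP q p) neq_pq => // [lt_qp _ | lt_pq _].
  case: (@avoids_meshA q p) => [||[r _]|[r _]] //; first by lia.
    by have := le_top r; lia.
  by lia.
apply/eqP; rewrite eqn_leq lt_pq andbT leqNgt; apply/negP=> lt_p1q.
have lt_p1 : p.+1 < n by have := ltn_ord q; lia.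
pose m := Ordinal lt_p1.
have neq_sm (i : 'I_n) : i != m :> nat -> s i != s m :> nat.
  by apply: contra => /eqP/val_inj/perm_inj->.
apply: (@avoids_meshD3 p m q) => /=; first by lia.
- have := le_top m; have := @neq_sm p; have := @neq_sm q; rewrite /=; lia.
- by move=> r _; lia.
by move=> r _.
Qed.

(** The position q is that of the letter 1, with the letter n just before it.
    Once the left block is known to lie above the right one, any descent
    completed by 1 (on the left) or by n (on the right) has empty shaded
    cells. *)
Lemma avoider_blocks : exists q : 'I_n,
  [/\ 0 < q,
      forall i j : 'I_n, i < q <= j -> s j < s i,
      forall i j : 'I_n, i < j < q -> s i < s j
    & forall i j : 'I_n, q <= i < j -> s i < s j].
Proof.
have [p [q [sp sq qE]]] := avoider_peak_bottom.
have neq_s (i j : 'I_n) : i != j :> nat -> s i != s j :> nat.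
  by apply: contra => /eqP/val_inj/perm_inj->.
have le_top (i : 'I_n) : s i <= s p by have := ltn_ord (s i); lia.
have above (i j : 'I_n) : i < q <= j -> s j < s i.
  move=> lt_iqj; have lt_iq : i < q by lia.
  have le_qj : q <= j by lia.
  case: (@arg_minnP _ i (fun k : 'I_n => k < q) (fun k => s k) lt_iq) => x lt_xq min_x.
  case: (@arg_maxnP _ j (fun k : 'I_n => q <= k) (fun k => s k) le_qj) => y le_qy max_y.
  (* x is the least letter of the left block and y the greatest letter of the
     right block; it suffices to refute x < y. *)
  have := min_x i lt_iq; have := max_y j le_qj.
  case: (ltnP (s y) (s x)) => [lt_yx | le_xy]; first by lia.
  have neq_xy := @neq_s x y.
  case: (@avoids_meshA x y) => [||[z lt_z lt_sz]|[z lt_z lt_sz]]; try lia.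
    (* z precedes x and exceeds y: the triple z x 1 is an occurrence of D3. *)
    case: (@avoids_meshD3 z x q) => [||r|r lt_r]; try lia.
      by have := @neq_s x q; lia.
    by have := max_y r; lia.
  (* z follows y and is below x: the triple n y z is an occurrence of D3. *)
  case: (@avoids_meshD3 p y z) => [||r lt_r|r _]; last exact: le_top.
  - by have := @neq_s y q; lia.
  - by have := le_top y; have := @neq_s p y; lia.
  by have := min_x r; lia.
exists q; split=> // [|i j lt_ijq|i j le_qij]; first by lia.
  case: (ltnP (s i) (s j)) => // le_ji.
  have neq_ij := @neq_s i j; have neq_jq := @neq_s j q.
  case: (@avoids_meshD3 i j q) => [||r|r lt_r]; try lia.
  by have := above i r; lia.
case: (ltnP (s i) (s j)) => // le_ji.
have neq_ij := @neq_s i j; have neq_pi := @neq_s p i; have := le_top i.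
move=> le_ip; case: (@avoids_meshD3 p i j) => [||r lt_r|r _]; try lia.
  by have := above r j; lia.
exact: le_top.
Qed.

(** Exchanging the two blocks of avoider_blocks gives an increasing word on
    the letters 1, ..., n, of which there is only one. *)
Lemma avoider_rotated : exists2 a, 2 <= a <= n & one_line s = rotated_word n a.
Proof.
have [q [q_gt0 above inc_l inc_r]] := avoider_blocks.
have lt_qn := ltn_ord q.
exists (n - q).+1; first by lia.
have nthE i (lt_i : i < n) := nth_one_line s (Ordinal lt_i).
have rot_sorted : rot q (one_line s) = iota 1 n.
  apply: (irr_sorted_eq ltn_trans ltnn); last 1 first.
  - move=> x; rewrite mem_rot; apply: perm_mem.
    by apply/one_line_perm_eq; exists s.
  - rewrite sorted_pairwise; last exact: ltn_trans.
    rewrite pairwise_cat; apply/and3P; split.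
    + apply/(all_nthP 0)=> i; rewrite size_drop size_one_line => lt_i.
      apply/(all_nthP 0)=> j; rewrite size_take size_one_line lt_qn => lt_j.
      have lt_qi : q + i < n by lia.
      have lt_jn : j < n by lia.
      rewrite nth_drop nth_take //= (nthE _ lt_qi) (nthE _ lt_jn) ltnS.
      by apply: above => /=; lia.
    + apply/(pairwiseP 0)=> i j; rewrite !inE size_drop size_one_line => lt_i lt_j lt_ij.
      have lt_qi : q + i < n by lia.
      have lt_qj : q + j < n by lia.
      rewrite !nth_drop (nthE _ lt_qi) (nthE _ lt_qj) ltnS.
      by apply: inc_r => /=; lia.
    apply/(pairwiseP 0)=> i j; rewrite !inE size_take size_one_line lt_qn => lt_i lt_j lt_ij.
    have lt_in : i < n by lia.
    have lt_jn : j < n by lia.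
    rewrite !nth_take // (nthE _ lt_in) (nthE _ lt_jn) ltnS.
    by apply: inc_l => /=; lia.
  exact: iota_ltn_sorted.
rewrite rotated_wordE /=; last by lia.
have := rotK q (one_line s).
by rewrite /rotr size_rot size_one_line rot_sorted.
Qed.

End Avoider.

(** * Enumeration *)

Lemma mem_one_line_avoiders n (w : seq nat) : 1 < n ->
  w \in [seq one_line s | s in avoiders n meshA meshD3] <->
  exists2 a, 2 <= a <= n & w = rotated_word n a.
Proof.
move=> n_gt1; split=> [/imageP[s s_av ->] | [a a_bd ->]].
  exact: avoider_rotated.
have /one_line_perm_eq[s s_rot] : perm_eq (rotated_word n a) (iota 1 n).
  by rewrite rotated_wordE ?perm_rot //; lia.
by rewrite s_rot; apply: image_f; apply: avoiders_rotated a_bd _.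
Qed.

Lemma card_avoiders n : 1 < n -> #|avoiders n meshA meshD3| = n - 1.
Proof.
move=> n_gt1; rewrite -(size_image (@one_line n)) -(size_iota 2 (n - 1)).
rewrite -(size_map (rotated_word n)); apply/perm_size/uniq_perm.
- by rewrite map_inj_uniq ?enum_uniq //; apply: one_line_inj.
- rewrite map_inj_in_uniq ?iota_uniq // => a b.
  by rewrite !mem_iota => a_bd b_bd; apply: rotated_word_inj; rewrite inE; lia.
move=> w; apply/idP/mapP => [|[a]].
  case/mem_one_line_avoiders=> // a a_bd ->.
  by exists a; rewrite // mem_iota; lia.
rewrite mem_iota => a_bd ->; apply/mem_one_line_avoiders => //.
by exists a; first by lia.
Qed.

Theorem theorem3p2 :
  (avoiders 1 meshA meshD3 = [set: 'S_1] /\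
   [seq one_line s | s in [set: 'S_1]] =i [:: [:: 1]]) /\
  (forall n : nat, 2 <= n ->
     #|avoiders n meshA meshD3| = n - 1 /\
     (forall w : seq nat,
        w \in [seq one_line s | s in avoiders n meshA meshD3] <->
        exists2 a : nat, 2 <= a <= n & w = rotated_word n a)).
Proof.
split=> [|n n_gt1]; last first.
  by split=> [|w]; [apply: card_avoiders | apply: mem_one_line_avoiders].
have word1 (s : 'S_1) : one_line s = [:: 1].
  by rewrite /one_line enum_ordSl /= enum_ord0 /= ord1.
split.
  apply/setP=> s; rewrite !inE; apply/andP; split.
    by apply/contains_meshAP=> -[i [j []]]; rewrite !ord1.
  by apply/contains_meshD3P=> -[i [j [k []]]]; rewrite !ord1.
move=> w; rewrite inE; apply/imageP/eqP => [[s _ ->] | ->]; first exact: word1.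
by exists 1%g; rewrite ?inE ?word1.
Qed.
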